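(* Let $X$ be a Hausdorff locally convex real topological vector space and assume that $(\mu_\alpha)$ is exponentially tight with respect to $(t_\alpha)$. Let $\mathcal{A}$ be the set of all finite minima of continuous affine functionals on $X$. If $\Lambda(h)$ exists for every $h$ in the negative part $\mathcal{A}_-$ of $\mathcal{A}$, then $(\mu_\alpha)$ satisfies a large deviation principle with powers $(t_\alpha)$ and rate function $$J(x)=\sup_{h\in\mathcal{A}_-}\{h(x)-\Lambda(h)\}=\sup_{h\in\mathcal{A}}\{h(x)-\overline{\Lambda}(h)\}=\sup_{h\in\mathcal{A}}\{h(x)-\underline{\Lambda}(h)\}=\sup_{h\in\mathcal{A}}\{h(x)-\lim_{M\to+\infty}\underline{\Lambda}(h_M)\}\quad\text{for all }x\in X.$$
   Context: $X$ is not reduced to one point. $(\mu_\alpha)$ is a net of Borel probability measures on $X$ and $(t_\alpha)$ a net (same index set) in $]0,+\infty[$ converging to $0$. Write $\mu_\alpha^{t_\alpha}(A)=(\mu_\alpha(A))^{t_\alpha}$ for Borel $A$, and for Borel measurable $h:X\to[-\infty,+\infty[$, $\mu_\alpha^{t_\alpha}(e^{h/t_\alpha})=\big(\int_X e^{h(x)/t_\alpha}\mu_\alpha(dx)\big)^{t_\alpha}$. Put $\overline\Lambda(h)=\log\limsup\mu_\alpha^{t_\alpha}(e^{h/t_\alpha})$, $\underline\Lambda(h)=\log\liminf\mu_\alpha^{t_\alpha}(e^{h/t_\alpha})$, and $\Lambda(h)=\log\lim\mu_\alpha^{t_\alpha}(e^{h/t_\alpha})$ when this limit exists (in $[-\infty,+\infty]$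 for $\Lambda(h)$). Conventions: $e^{-\infty}=0$, $\log0=-\infty$. Large deviation principle with powers $(t_\alpha)$: for a function $l:X\to[0,+\infty]$, $\limsup\mu_\alpha^{t_\alpha}(F)\le\sup_{x\in F}e^{-l(x)}$ for all closed $F$ and $\sup_{x\in G}e^{-l(x)}\le\liminf\mu_\alpha^{t_\alpha}(G)$ for all open $G$; the lower regularization of $l$ (the greatest lower semi-continuous function $\le l$) is then called a rate function. $(\mu_\alpha)$ is exponentially tight with respect to $(t_\alpha)$ if for each $\varepsilon>0$ there is a compact $K\subset X$ with $\limsup\mu_\alpha^{t_\alpha}(X\setminus K)<\varepsilon$. A continuous affine functional is a function of the form $u+c$ with $u$ in the topological dual of $X$ and $c\in\mathbb{R}$. $\mathcal{A}_-=\{h\in\mathcal{A}:h\le0\}$. For $h\in\mathcal{A}$ and real $M$, $h_M=h1_{\{h<M\}}-\infty1_{\{h\ge M\}}$ (i.e. $h_M=h$ on $\{h<M\}$ and $-\infty$ elsewhere). *)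

(* Defs.v *)
From HB Require Import structures.
From mathcomp Require Import all_boot all_order all_algebra.
From mathcomp Require Import all_classical all_reals all_analysis.

Set Implicit Arguments.
Unset Strict Implicit.
Unset Printing Implicit Defensive.

Import Order.TTheory GRing.Theory Num.Theory.
Import numFieldNormedType.Exports.

Local Open Scope classical_set_scope.
Local Open Scope ring_scope.

(* The measurable structures of the library live on pointed types, which a
   [tvsType] is not; the distinguished point is 0. *)
Definition pointed_tvs (R : realType) (X : tvsType R) : Type := X.
HB.instance Definition _ (R : realType) (X : tvsType R) :=
  Choice.on (pointed_tvs X).
HB.instance Definition _ (R : realType) (X : tvsType R) :=
  isPointed.Build (pointed_tvs X) (0 : X).

Definition borelType (R : realType) (X : tvsType R) :=
  g_sigma_algebraType (@open X : set (set (pointed_tvs X))).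

Definition directed_preorder (I : Type) (le : I -> I -> Prop) : Prop :=
  [/\ inhabited I,
      forall i, le i i,
      forall i j k, le i j -> le j k -> le i k
    & forall i j, exists k, le i k /\ le j k].

Definition net_filter (I : Type) (le : I -> I -> Prop) : set_system I :=
  [set A | exists i, forall j, le i j -> A j].

(* The library's [limf_esup] and [limf_einf] ask for a [filteredType] as the
   domain, which a bare index set is not. *)
Definition net_limsup (R : realType) (I : Type) (le : I -> I -> Prop)
    (u : I -> \bar R) : \bar R :=
  ereal_inf [set ereal_sup [set u j | j in le i] | i in [set: I]].

Definition net_liminf (R : realType) (I : Type) (le : I -> I -> Prop)
    (u : I -> \bar R) : \bar R :=
  ereal_sup [set ereal_inf [set u j | j in le i] | i in [set: I]].

Section LargeDeviations.
Context (R : realType) (X : tvsType R) (I : Type) (le : I -> I -> Prop).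
Context (mu : I -> probability (borelType X) R) (t : I -> R).
Implicit Types (A : set X) (h : X -> \bar R) (l J : X -> \bar R).

Local Open Scope ereal_scope.

Definition mu_pow A : I -> \bar R := fun i => mu i A `^ t i.

Definition exp_functional h : I -> \bar R :=
  fun i => (\int[mu i]_x expeR (h x * ((t i)^-1)%:E)) `^ t i.

Definition Lambda_sup h : \bar R := lne (net_limsup le (exp_functional h)).

Definition Lambda_inf h : \bar R := lne (net_liminf le (exp_functional h)).

Definition Lambda_exists h : Prop := cvg (exp_functional h @ net_filter le).

(* Only meaningful under [Lambda_exists h]. *)
Definition Lambda h : \bar R := lne (lim (exp_functional h @ net_filter le)).

Definition exponentially_tight : Prop :=
  forall eps : R, (0 < eps)%R ->
    exists2 K : set X, compact K & net_limsup le (mu_pow (~` K)) < eps%:E.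

(* The supremum is taken in [0, +oo]: it is 0, not -oo, when A is empty. *)
Definition sup_exp_opp l A : \bar R :=
  ereal_sup ([set 0] `|` [set expeR (- l x) | x in A]).

Definition ldp_bounds l : Prop :=
  (forall F : set X, closed F ->
     net_limsup le (mu_pow F) <= sup_exp_opp l F) /\
  (forall G : set X, open G ->
     sup_exp_opp l G <= net_liminf le (mu_pow G)).

Definition lower_regularization_of l J : Prop :=
  [/\ lower_semicontinuous J,
      forall x, J x <= l x
    & forall g : X -> \bar R, lower_semicontinuous g ->
        (forall x, g x <= l x) -> forall x, g x <= J x].

Definition ldp_with_rate_function J : Prop :=
  exists l : X -> \bar R,
    [/\ forall x, 0 <= l x, ldp_bounds l & lower_regularization_of l J].

End LargeDeviations.

Section AffineFunctionals.
Context (R : realType) (X : tvsType R).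

Definition continuous_affine (f : X -> R) : Prop :=
  exists (u : {linear X -> R^o}) (c : R),
    continuous u /\ f = (fun x => u x + c).

Definition finite_min_affine : set (X -> R) :=
  [set h | exists (n : nat) (a : 'I_n.+1 -> X -> R),
     (forall i, continuous_affine (a i)) /\
     h = (fun x => \big[Num.min/a ord0 x]_(i < n.+1) a i x)].

Definition neg_finite_min_affine : set (X -> R) :=
  [set h | finite_min_affine h /\ forall x, h x <= 0].

Definition cut_below (h : X -> R) (M : R) : X -> \bar R :=
  fun x => if h x < M then (h x)%:E else -oo%E.

End AffineFunctionals.

(* Main.v *)
(* Let [J x] be the supremum of [h x - Lambda_inf h] over the negative minima
   [h].  The upper bound is Markov's inequality on the sets [h > h x - delta]
   together with compactness and exponential tightness; it involves
   [Lambda_sup h], which is where the existence of the limits is used.  For the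
   lower bound on an open set containing [x], the Hahn-Banach theorem and
   compactness give a negative minimum [h] vanishing at [x] and very negative on
   [K `\` G]; then [Lambda_inf h], which is at least [- J x], is essentially at
   most [log (liminf mu^t (G))].  The lower bound on the sets
   [h x - delta < h < M] yields [h x - J x <= Lambda_inf (h_M)] for [M > h x],
   whence all the expressions of [J]. *)
Require Import Defs.
From HB Require Import structures.
From mathcomp Require Import all_boot all_order all_algebra.
From mathcomp Require Import all_classical all_reals all_analysis.
From mathcomp Require Import measurable_realfun ring lra.

Set Implicit Arguments.
Unset Strict Implicit.
Unset Printing Implicit Defensive.

Import Order.TTheory GRing.Theory Num.Theory.
Import numFieldNormedType.Exports.

Local Open Scope classical_set_scope.
Local Open Scope ring_scope.

(** * Sublinear functionals and the Hahn-Banach theorem *)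

Section Sublinear.
Context (R : realType) (X : lmodType R).
Implicit Types (p q : X -> R) (x y : X).

(** Homogeneity is stated as an inequality for [r > 0], a form that passes directly to infima;
    applied to [r^-1] it gives the reverse inequality. *)
Definition sublinear q : Prop :=
  (forall x y, q (x + y) <= q x + q y) /\
  (forall (r : R) x, 0 < r -> q (r *: x) <= r * q x).

Lemma sublinear0 q : sublinear q -> q 0 = 0.
Proof.
move=> [qD qZ]; have := qD 0 0; have /(_ 0) := qZ 2^-1 _ _.
by rewrite addr0 scaler0 => /(_ ltac:(lra)); lra.
Qed.

Lemma sublinearZ q r x : sublinear q -> 0 <= r -> q (r *: x) = r * q x.
Proof.
move=> qs; rewrite le_eqVlt => /predU1P[<-|r0].
  by rewrite scale0r mul0r sublinear0.
apply/eqP; rewrite eq_le qs.2//= -ler_pdivlMl//.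
by rewrite -[in leLHS](scalerK (lt0r_neq0 r0) x) qs.2// invr_gt0.
Qed.

(** Serves three constructions: the refinement of a functional, the infimum of a chain, and the
    gauge of a convex set. *)
Lemma inf_sublinear (S : X -> set R) :
  (forall x, S x !=set0) -> (forall x, has_lbound (S x)) ->
  (forall x y a b, S x a -> S y b -> exists2 c, S (x + y) c & c <= a + b) ->
  (forall (r : R) x a, 0 < r -> S x a -> exists2 c, S (r *: x) c & c <= r * a) ->
  sublinear (fun x => inf (S x)).
Proof.
move=> S0 Slb SD SZ; split=> [x y|r x r0].
  rewrite -lerBlDr; apply: lb_le_inf => // a Sa.
  rewrite lerBlDr -lerBlDl; apply: lb_le_inf => // b Sb.
  rewrite lerBlDl; have [c Sc] := SD _ _ _ _ Sa Sb.
  by apply: le_trans; exact: ge_inf.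
rewrite -ler_pdivrMl//; apply: lb_le_inf => // a Sa.
rewrite ler_pdivrMl//; have [c Sc] := SZ _ _ _ r0 Sa.
by apply: le_trans; exact: ge_inf.
Qed.

(** Take the infimum of [q (x + s *: y) - s * q y] over [s >= 0]: subadditivity bounds it below by
    [- q (- x)], and [s = 0], [s = 1] give the two upper bounds. *)
Lemma sublinear_refine q y : sublinear q ->
  exists q', [/\ sublinear q', forall x, q' x <= q x &
    forall x, q' x <= q (x + y) - q y].
Proof.
move=> qs; have [qD qZ] := qs.
pose S x := [set q (x + s *: y) - s * q y | s in [set s | 0 <= s]].
have Slb x : has_lbound (S x).
  exists (- q (- x)) => _ [s /= s0 <-].
  have := qD (x + s *: y) (- x).
  by rewrite addrC addKr sublinearZ//; lra.
exists (fun x => inf (S x)); split.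
- apply: inf_sublinear => //.
  + by move=> x; exists (q (x + 0 *: y) - 0 * q y), 0 => /=.
  + move=> x1 x2 _ _ [s /= s0 <-] [s' /= s'0 <-].
    eexists; first by exists (s + s') => //=; rewrite addr_ge0.
    by have := qD (x1 + s *: y) (x2 + s' *: y); rewrite addrACA -scalerDl; lra.
  + move=> r x _ r0 [s /= s0 <-].
    eexists; first by exists (r * s) => //=; rewrite mulr_ge0// ltW.
    by have := qZ _ (x + s *: y) r0; rewrite scalerDr scalerA; lra.
- move=> x; apply: ge_inf => //; exists 0 => //=.
  by rewrite scale0r addr0 mul0r subr0.
- move=> x; apply: ge_inf => //; exists 1 => //=.
  by rewrite scale1r mul1r.
Qed.

(** Zorn's lemma for the reversed pointwise order: a nonempty chain has its pointwise infimum as a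
    bound, finite because each member is at least [- p (- x)] at [x]. *)
Lemma minimal_sublinear p : sublinear p ->
  exists q, [/\ sublinear q, forall x, q x <= p x &
    forall q', sublinear q' -> (forall x, q' x <= q x) -> q' = q].
Proof.
move=> ps; pose P q := `[< sublinear q /\ forall x, q x <= p x >].
pose T := {q | P q}; pose le (a b : T) := `[< forall x, sval b x <= sval a x >].
have inP (a : T) : sublinear (sval a) /\ forall x, sval a x <= p x.
  by case: a => a /= /asboolP.
have [|a b c /asboolP ab /asboolP bc| |A Atot|[q Pq] qmin] := @Zorn T le.
- by move=> a; apply/asboolP.
- by apply/asboolP => x; exact: le_trans (bc x) (ab x).
- move=> [a Pa] [b Pb] /asboolP /= ab /asboolP /= ba.
  by apply: eq_exist; apply/funext => x; apply/le_anti; rewrite ab ba.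
(* The empty chain is bounded by [p] itself. *)
- have [[a0 Aa0]|A0] := pselect (A !=set0); last first.
    have Pp : P p by apply/asboolP.
    by exists (exist (fun q => P q) p Pp) => s As; case: A0; exists s.
  pose S x := [set sval a x | a in A].
  have Slb x : has_lbound (S x).
    exists (- p (- x)) => _ [a Aa <-]; have [as_ ap] := inP a.
    by have := as_.1 x (- x); have := ap (- x); rewrite subrr sublinear0//; lra.
  have Pq : P (fun x => inf (S x)).
    apply/asboolP; split; last first.
      move=> x; apply: (le_trans _ ((inP a0).2 x)).
      by apply: ge_inf => //; exists a0.
    apply: inf_sublinear => //.
    + by move=> x; exists (sval a0 x), a0.
    + move=> x y _ _ [a Aa <-] [b Ab <-].
      have [/asboolP ab|/asboolP ba] := Atot _ _ Aa Ab.
      * exists (sval b (x + y)); first by exists b.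
        by rewrite (le_trans ((inP b).1.1 x y))// lerD2r.
      * exists (sval a (x + y)); first by exists a.
        by rewrite (le_trans ((inP a).1.1 x y))// lerD2l.
    + move=> r x _ r0 [a Aa <-]; exists (sval a (r *: x)); first by exists a.
      exact: (inP a).1.2.
  exists (exist (fun q => P q) _ Pq) => a Aa; apply/asboolP => x /=.
  by apply: ge_inf => //; exists a.
- move/asboolP : (Pq) => [qs qp]; exists q; split => // q' q's q'q.
  have Pq' : P q' by apply/asboolP; split => // x; exact: le_trans (q'q x) (qp x).
  have /qmin[->//] : le (exist (fun q => P q) q Pq) (exist (fun q => P q) q' Pq').
  exact/asboolP.
Qed.

(* A minimal sublinear functional [u] coincides with its refinement in every
   direction [y], so [u x <= u (x + y) - u y]. *)
Lemma hahn_banach p x0 : sublinear p ->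
  exists u : {linear X -> R^o}, (forall x, u x <= p x) /\ u x0 = p x0.
Proof.
(* Refining [p] at [x0] first forces [u (- x0) <= p 0 - p x0], hence [p x0 <= u x0] for the linear
   [u] below [p']. *)
move=> ps; have [p' [p's p'p p'x0]] := sublinear_refine x0 ps.
have [u [us up' umin]] := minimal_sublinear p's.
have uD x y : u (x + y) = u x + u y.
  have [v [vs vu vy]] := sublinear_refine y us.
  have := vy x; rewrite (umin _ vs vu) => uxy.
  by apply/le_anti; rewrite us.1/=; lra.
have uN x : u (- x) = - u x.
  by have := uD x (- x); rewrite subrr sublinear0//; lra.
have ulin : linear (u : X -> R^o).
  move=> r x y; rewrite uD; congr (_ + _).
  have [r0|r0] := leP 0 r; first by rewrite sublinearZ.
  rewrite -[r]opprK scaleNr uN sublinearZ ?oppr_ge0 1?ltW//.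
  by rewrite scaleNr; congr (- _).
pose uL := GRing.isLinear.Build R X R^o *:%R u ulin.
pose U : {linear X -> R^o} := HB.pack u uL.
exists U; split=> [x|]; first exact: le_trans (up' x) (p'p x).
apply/le_anti; rewrite (le_trans (up' _) (p'p _))//=.
have := le_trans (up' (- x0)) (p'x0 _).
by rewrite uN addNr (sublinear0 ps) sub0r lerN2.
Qed.

End Sublinear.

(** * Gauges and separation of a point from 0 *)

Section Separation.
Context (R : realType) (X : tvsType R).

Lemma convex_combination (B : set X) (x y : X) (r : R) :
  convex_set (B : set (convex_lmodType X)) -> B x -> B y -> 0 <= r <= 1 ->
  B (r *: x + (1 - r) *: y).
Proof.
move=> Bcvx Bx By r01.
have := Bcvx x y (Itv01 (andP r01).1 (andP r01).2).
by rewrite !inE => /(_ Bx By).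
Qed.

(** By continuity of scaling at [(0, x)], [B] contains [s *: x] for [s] within some [e] of 0; the
    choice is [r^-1 = e / 2]. *)
Lemma nbhs0_absorbing (B : set X) (x : X) : nbhs 0 B ->
  exists2 r : R, 0 < r & B (r^-1 *: x).
Proof.
move=> B0.
have /= := @scale_continuous R X (0, x) B.
rewrite scale0r => /(_ B0)[[U V] /= [[e /= e0 eU] /nbhs_singleton Vx] UVB].
have small : `|0 - (2 / e)^-1| < e.
  rewrite sub0r normrN invf_div ger0_norm ?divr_ge0// ?ltW//.
  by rewrite ltr_pdivrMr//; lra.
exists (2 / e); first by rewrite divr_gt0.
by apply: (UVB ((2 / e)^-1, x)); split => //; exact: eU.
Qed.

Lemma gauge_sublinear (B : set X) :
  convex_set (B : set (convex_lmodType X)) -> nbhs 0 B ->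
  sublinear (fun x => inf [set r : R | 0 < r /\ B (r^-1 *: x)]).
Proof.
move=> Bcvx B0; apply: inf_sublinear.
- by move=> x; have [r r0 Br] := nbhs0_absorbing x B0; exists r.
- by move=> x; exists 0 => r [/ltW].
- move=> x y r s [r0 Br] [s0 Bs]; exists (r + s) => //.
  split; first by rewrite addr_gt0.
  have rs0 : 0 < r + s by rewrite addr_gt0.
  (* A convex combination of two points of [B]. *)
  have -> : (r + s)^-1 *: (x + y) =
      (r / (r + s)) *: (r^-1 *: x) + (1 - r / (r + s)) *: (s^-1 *: y).
    rewrite !scalerA scalerDr; congr (_ *: _ + _ *: _); field;
    by rewrite ?gt_eqF.
  apply: convex_combination => //.
  have -> : 0 <= r / (r + s) by rewrite divr_ge0 ?ltW.
  by rewrite /= ler_pdivrMr ?addr_gt0// mul1r lerDl ltW.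
- move=> r x s r0 [s0 Bs]; exists (r * s) => //; split; first exact: mulr_gt0.
  by rewrite scalerA invfM -mulrA mulrC -mulrA divff ?gt_eqF// mulr1.
Qed.

(** The one-sided bound on [B] gives [u z - u x <= e] on [x + e B] and [u x - u z <= e] on
    [x - e B]; both are neighbourhoods of [x]. *)
Lemma linear_bounded_above_continuous (u : {linear X -> R^o}) (B : set X) :
  nbhs 0 B -> (forall x, B x -> u x <= 1) -> continuous u.
Proof.
move=> B0 uB x; apply/cvgrPdist_le => e e0.
have en0 : e != 0 by rewrite gt_eqF.
have eB := nbhsT x (nbhs0Z en0 B0).
have eNB := nbhsT x (nbhs0Z en0 (nbhs0N B0)).
near=> z.
have [_ [b Bb <-] bz] : (+%R x @` ( *:%R e @` B)) z by near: z.
have [_ [_ [b' Bb' <-] <-] b'z] :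
    (+%R x @` ( *:%R e @` (-%R @` B))) z by near: z.
rewrite ler_norml; apply/andP; split.
  rewrite -bz linearD linearZ/= opprD addNKr lerN2.
  by rewrite -[leRHS]mulr1; apply: ler_wpM2l; [exact: ltW|exact: uB].
rewrite -b'z linearD linearZ/= linearN opprD addNKr scalerN opprK.
by rewrite -[leRHS]mulr1; apply: ler_wpM2l; [exact: ltW|exact: uB].
Unshelve. all: by end_near. Qed.

(** Hahn-Banach is applied to the gauge of a convex neighbourhood [B] of 0 that misses [x0]. The
    gauge is at most 1 on [B], which gives continuity, and at least 1 at [x0]. *)
Lemma continuous_linear_separation (x0 : X) : hausdorff_space X -> x0 != 0 ->
  exists2 u : {linear X -> R^o}, continuous u & 0 < u x0.
Proof.
move=> Xh x00.
have [A A0 Ax0] : exists2 A, nbhs 0 A & ~ A x0.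
  apply: contrapT => noA; move/eqP : x00; apply; apply: Xh => A B Ax0 B0.
  exists x0; split; first exact: nbhs_singleton.
  by apply: contrapT => Bx0; apply: noA; exists B.
have [Bs Bcvx [Bo Bb]] := @locally_convex R X.
have [B [BsB B0] BA] := Bb 0 A A0.
have nB0 : nbhs 0 B by apply: open_nbhs_nbhs; split => //; exact: Bo.
have cB : convex_set (B : set (convex_lmodType X)) by apply: Bcvx; rewrite inE.
pose p x := inf [set r : R | 0 < r /\ B (r^-1 *: x)].
have ps : sublinear p by exact: gauge_sublinear.
have [u [up ux0]] := hahn_banach x0 ps.
exists u.
  apply: (linear_bounded_above_continuous nB0) => x Bx.
  rewrite (le_trans (up x))//; apply: ge_inf; first by exists 0 => r [/ltW].
  by split => //; rewrite invr1 scale1r.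
rewrite ux0 (lt_le_trans (ltr01 : 0 < 1 :> R))//; apply: lb_le_inf.
  by have [r r0 Br] := nbhs0_absorbing x0 nB0; exists r.
(* If [r < 1], then [x0] lies on the segment from 0 to [r^-1 *: x0], hence in [B]. *)
move=> r [r0 Br]; rewrite leNgt; apply/negP => r1; apply/Ax0/BA.
have -> : x0 = r *: (r^-1 *: x0) + (1 - r) *: 0.
  by rewrite scaler0 addr0 scalerA divff ?gt_eqF// scale1r.
by apply: convex_combination => //; rewrite !ltW.
Qed.

End Separation.

(** * Finite minima of continuous affine functionals *)

Section FiniteMinAffine.
Context (R : realType) (X : tvsType R).
Implicit Types h : X -> R.

Lemma continuous_affine_finite_min h :
  continuous_affine h -> finite_min_affine h.
Proof.
move=> ha; exists 0%N, (fun=> h); split => //; apply/funext => x.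
by rewrite big_ord_recl big_ord0 minxx.
Qed.

Lemma cst_affine (c : R) : continuous_affine (fun _ : X => c).
Proof.
exists (\0 : {linear X -> R^o}), c; split; first by move=> x; exact: cvg_cst.
by apply/funext => x; rewrite add0r.
Qed.

Lemma finite_min_affine_min h1 h2 :
  finite_min_affine h1 -> finite_min_affine h2 ->
  finite_min_affine (fun x => Num.min (h1 x) (h2 x)).
Proof.
move=> [n [a [aa ->]]] [m [b [ba ->]]].
(* The two families are concatenated; [n.+1 + m.+1] is convertible to the successor of
   [n + m.+1]. *)
pose c (i : 'I_(n.+1 + m.+1)) :=
  match fintype.split i with inl j => a j | inr k => b k end.
have ca j : c (lshift _ j) = a j by rewrite /c (unsplitK (inl j)).
have cb k : c (rshift _ k) = b k by rewrite /c (unsplitK (inr k)).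
exists (n + m.+1)%N, c; split; first by move=> i; rewrite /c; case: fintype.split.
apply/funext => x; apply/le_anti/andP; split.
  have minE (i : 'I_(n.+1 + m.+1)) :
      Num.min (\big[Num.min/a ord0 x]_(j < n.+1) a j x)
              (\big[Num.min/b ord0 x]_(k < m.+1) b k x) <= c i x.
    rewrite -(fintype.splitK i); case: (fintype.split i) => [j|k] /=.
      by rewrite ca ge_min bigmin_le.
    by rewrite cb ge_min bigmin_le orbT.
  (* The default value of the big minimum is itself a member of the family, so the same bound covers
     it. *)
  by apply/bigmin_geP; split=> [|i _]; exact: minE.
rewrite le_min; apply/andP; split; apply/bigmin_geP; split=> [|i _].
- by rewrite -ca bigmin_le.
- by rewrite -ca bigmin_le.
- by rewrite -cb bigmin_le.
- by rewrite -cb bigmin_le.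
Qed.

Lemma finite_min_affine_continuous h :
  finite_min_affine h -> continuous (h : X -> R^o).
Proof.
move=> [n [a [aa ->]]].
have ac i : continuous (a i : X -> R^o).
  have [u [c [uc ->]]] := aa i.
  by move=> x; apply: cvgD; [exact: uc|exact: cvg_cst].
elim: (index_enum _) => [|i s IHs] x.
  by under eq_fun do rewrite big_nil; exact: ac.
by under eq_fun do rewrite big_cons; apply: continuous_min; [exact: ac|exact: IHs].
Qed.

End FiniteMinAffine.

(* [P] is an ideal of sets; its dual filter is fed to the near-covering
   characterization of compactness. *)
Lemma compact_ideal (T : topologicalType) (K : set T) (P : set T -> Prop) :
  compact K -> P set0 -> (forall A B, P A -> P B -> P (A `|` B)) ->
  (forall x, K x -> exists2 V, nbhs x V & P V) ->
  exists2 A, P A & K `<=` A.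
Proof.
move=> /compact_near_coveringP cK P0 PU PK.
pose F : set_system (set T) := filter_from P (fun A => [set B | A `<=` B]).
have FF : Filter F.
  apply: filter_from_filter; first by exists set0.
  by move=> A B PA PB; exists (A `|` B); [exact: PU|move=> C /=; rewrite subUset].
have [x Kx|A PA AK] := cK _ F (fun A x => A x) FF.
  have [V xV PV] := PK _ Kx.
  exists (V, [set B | V `<=` B]); first by split => //; exists V.
  by move=> [y B] [/= Vy]; apply.
by exists A => //; exact: AK.
Qed.

(** * Upper and lower limits along a net *)

Section NetLimits.
Context (R : realType) (I : Type) (le : I -> I -> Prop).
Hypothesis le_directed : directed_preorder le.
Implicit Types (u v : I -> \bar R) (a l : \bar R).
Local Open Scope ereal_scope.

Lemma ereal_dense a l : a < l -> exists r : R, a < r%:E < l.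
Proof.
case: a l => [a| |] [l| |] //; rewrite ?lte_fin => al.
- by exists ((a + l) / 2)%R; rewrite !lte_fin; apply/andP; split; lra.
- by exists (a + 1)%R; rewrite ltry lte_fin ltrDl ltr01.
- by exists (l - 1)%R; rewrite ltNyr lte_fin ltrBlDr ltrDl ltr01.
- by exists 0%R; rewrite ltNyr ltry.
Qed.

Lemma le_from_real a l : (forall r : R, l < r%:E -> a <= r%:E) -> a <= l.
Proof.
move=> la; rewrite leNgt; apply/negP => /ereal_dense[r /andP[lr ra]].
by have := la r lr; rewrite leNgt ra.
Qed.

Lemma net_filter_proper : ProperFilter (net_filter le).
Proof.
have [[i0] lexx letr led] := le_directed.
split; first by move=> [i /(_ i (lexx i))].
split; first by exists i0.
  move=> P Q [i iP] [j jQ]; have [k [ik jk]] := led i j.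
  by exists k => m km; split; [apply: iP; exact: letr km|apply: jQ; exact: letr km].
by move=> P Q PQ [i iP]; exists i => j /iP; exact: PQ.
Qed.

Lemma near_net_limsup_lt u a : net_limsup le u < a ->
  \forall i \near net_filter le, u i < a.
Proof.
move=> /ereal_inf_lt[_ [i _ <-] supa]; exists i => j ij.
by apply: le_lt_trans supa; apply: ereal_sup_ubound; exists j.
Qed.

Lemma net_limsup_near_le u a :
  (\forall i \near net_filter le, u i <= a) -> net_limsup le u <= a.
Proof.
move=> [i iu]; apply: ge_ereal_inf; eexists; first by exists i.
by apply: ge_ereal_sup => _ [j ij <-]; exact: iu.
Qed.

Lemma near_net_liminf_gt u a : a < net_liminf le u ->
  \forall i \near net_filter le, a < u i.
Proof.
move=> /ereal_sup_gt[_ [i _ <-] infa]; exists i => j ij.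
by apply: (lt_le_trans infa); apply: ereal_inf_lbound; exists j.
Qed.

Lemma net_liminf_near_ge u a :
  (\forall i \near net_filter le, a <= u i) -> a <= net_liminf le u.
Proof.
move=> [i iu]; apply: le_ereal_sup_tmp; eexists; first by exists i.
by apply: le_ereal_inf_tmp => _ [j ij <-]; exact: iu.
Qed.

(** A lower limit below [a] puts [u] below [a] only at arbitrarily late indices, which suffices to
    meet an eventual property. *)
Lemma net_liminf_lt_frequently u a (P : I -> Prop) : net_liminf le u < a ->
  (\forall i \near net_filter le, P i) -> exists2 i, P i & u i < a.
Proof.
move=> ua [i iP]; have : ereal_inf [set u j | j in le i] < a.
  by apply: le_lt_trans ua; apply: ereal_sup_ubound; exists i.
by move=> /ereal_inf_lt[_ [j ij <-] uja]; exists j => //; exact: iP.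
Qed.

Lemma net_liminf_le_limsup u : net_liminf le u <= net_limsup le u.
Proof.
apply: le_from_real => r /near_net_limsup_lt ur; rewrite leNgt; apply/negP => ru.
have PF := net_filter_proper.
have [i [ui iu]] := filter_ex (filterI ur (near_net_liminf_gt ru)).
by have := lt_trans ui iu; rewrite ltxx.
Qed.

Lemma le_net_liminf u v : (forall i, u i <= v i) ->
  net_liminf le u <= net_liminf le v.
Proof.
move=> uv; apply: ge_ereal_sup => _ [i _ <-]; apply: net_liminf_near_ge.
exists i => j ij; apply: le_trans (uv j).
by apply: ereal_inf_lbound; exists j.
Qed.

Lemma le_net_limsup u v : (forall i, u i <= v i) ->
  net_limsup le u <= net_limsup le v.
Proof.
move=> uv; apply: le_from_real => r /near_net_limsup_lt vr.
have PF := net_filter_proper.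
by apply: net_limsup_near_le; apply: filterS vr => i /(le_lt_trans (uv i))/ltW.
Qed.

Lemma net_cvg_limits u l : u i @[i --> net_filter le] --> l ->
  net_limsup le u = l /\ net_liminf le u = l.
Proof.
move=> ul; have lel : net_limsup le u <= l.
  apply: le_from_real => r lr; apply: net_limsup_near_le.
  have PF := net_filter_proper.
  have near_u : \forall i \near net_filter le, u i < r%:E.
    exact: (ul _ (open_ereal_lt' lr)).
  by apply: filterS near_u => i /ltW.
have lle : l <= net_liminf le u.
  rewrite leNgt; apply/negP => /ereal_dense[r /andP[ur rl]].
  have : r%:E <= net_liminf le u; last by rewrite leNgt ur.
  apply: net_liminf_near_ge.
  have PF := net_filter_proper.
  have near_u : \forall i \near net_filter le, r%:E < u i.
    exact: (ul _ (open_ereal_gt' rl)).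
  by apply: filterS near_u => i /ltW.
have ll := net_liminf_le_limsup u.
by split; apply/le_anti; rewrite ?lel ?lle ?(le_trans lle ll) ?(le_trans ll lel).
Qed.

End NetLimits.

(** * Integrals, powers and exponentials in the extended reals *)

Section PowerBounds.
Context (R : realType).
Local Open Scope ereal_scope.

(** Measurability of [f] and [g] does not enter: the integral of a nonnegative function is a
    supremum over the simple functions below it. *)
Lemma ge0_le_integral_setT d (T : measurableType d)
    (m : {measure set T -> \bar R}) (f g : T -> \bar R) :
  (forall x, 0 <= f x) -> (forall x, f x <= g x) ->
  \int[m]_x f x <= \int[m]_x g x.
Proof.
move=> f0 fg; have g0 x : 0 <= g x by exact: le_trans (f0 x) (fg x).
rewrite !ge0_integralTE//; apply: ereal_sup_le => _ [h /= hf <-].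
by exists h => //= x; exact: le_trans (hf x) (fg x).
Qed.

Lemma le_poweR (x y : \bar R) (r : R) : (0 <= r)%R -> 0 <= x -> x <= y ->
  x `^ r <= y `^ r.
Proof.
move=> r0 x0 xy; apply: gt0_ler_poweR => //.
  by rewrite in_itv/= x0 leey.
by rewrite in_itv/= (le_trans x0 xy) leey.
Qed.

Lemma poweR_le_root (x : \bar R) (c r : R) : (0 < r)%R -> 0 <= x ->
  x `^ r <= c%:E -> x <= (c `^ r^-1)%:E.
Proof.
move=> r0 x0 xc; have -> : x = (x `^ r) `^ r^-1.
  by rewrite -poweRrM divff ?gt_eqF// poweRe1.
by rewrite -poweR_EFin le_poweR ?invr_ge0 ?poweR_ge0// ltW.
Qed.

Lemma expeR_lne (x : \bar R) : 0 <= x -> expeR (lne x) = x.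
Proof. by rewrite -lneK_eq => /eqP. Qed.

Lemma le_lne (x y : \bar R) : 0 <= x -> x <= y -> lne x <= lne y.
Proof.
by move=> x0 xy; rewrite -lee_expeR !expeR_lne// (le_trans x0).
Qed.

Lemma leeB_swap (r : R) (x y : \bar R) : r%:E - x <= y -> r%:E - y <= x.
Proof.
case: x y => [x| |] [y| |]; rewrite ?leey ?leNye//.
  by rewrite -!EFinB !lee_fin !lerBlDr addrC.
Qed.

Lemma powR_expR_div (s r : R) : (0 < r)%R -> (expR (s / r) `^ r = expR s)%R.
Proof. by move=> r0; rewrite -expRM divfK// gt_eqF. Qed.

End PowerBounds.

(** * Large deviation bounds *)

Section LargeDeviationBounds.
Context (R : realType) (X : tvsType R) (I : Type) (le : I -> I -> Prop).
Hypothesis le_directed : directed_preorder le.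
Context (mu : I -> probability (borelType X) R) (t : I -> R).
Hypothesis t_gt0 : forall i, (0 < t i)%R.
Hypothesis t_cvg0 : t @ net_filter le --> (0 : R).
Local Open Scope ereal_scope.

Let net_filter_filter := net_filter_proper le_directed.
Local Existing Instance net_filter_filter.

Lemma open_borel (A : set X) : open A ->
  measurable (A : set (borelType X)).
Proof. by move=> oA; apply: sub_sigma_algebra. Qed.

Lemma mu_pow_ge0 (A : set X) i : 0 <= mu_pow mu t A i.
Proof. exact: poweR_ge0. Qed.

Lemma exp_functional_ge0 (h : X -> \bar R) i : 0 <= exp_functional mu t h i.
Proof. exact: poweR_ge0. Qed.

Lemma net_liminf_ge0 (u : I -> \bar R) : (forall i, 0 <= u i) ->
  0 <= net_liminf le u.
Proof. by move=> u0; apply: net_liminf_near_ge; apply: nearW. Qed.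

Lemma net_limsup_ge0 (u : I -> \bar R) : (forall i, 0 <= u i) ->
  0 <= net_limsup le u.
Proof.
by move=> u0; apply: le_trans (net_liminf_ge0 u0) (net_liminf_le_limsup _ _).
Qed.

Lemma exp_functional_le (g h : X -> \bar R) i : (forall x, g x <= h x) ->
  exp_functional mu t g i <= exp_functional mu t h i.
Proof.
move=> gh; apply: le_poweR; first exact: ltW.
  by apply: integral_ge0 => x _; exact: expeR_ge0.
apply: ge0_le_integral_setT => x; first exact: expeR_ge0.
by rewrite lee_expeR lee_wpmul2r// lee_fin invr_ge0 ltW.
Qed.

(** Integrate [exp (s / t) 1_V <= exp (h / t)]; the power [t] turns the constant [exp (s / t)] into
    [exp s]. *)
Lemma markov_exp_functional (h : X -> \bar R) (V : set X) (s : R) i :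
  open V -> (forall x, V x -> s%:E <= h x) ->
  (expR s)%:E * mu_pow mu t V i <= exp_functional mu t h i.
Proof.
move=> oV sh; have mV := open_borel oV.
rewrite -(powR_expR_div s (t_gt0 i)) -poweR_EFin -poweRM ?lee_fin ?expR_ge0//.
apply: le_poweR; [exact: ltW|by rewrite mule_ge0// lee_fin expR_ge0|].
rewrite -[in mu i V](setIT V) -integral_indic// -ge0_integralZl//; last first.
  exact/measurable_EFinP.
apply: ge0_le_integral_setT => x.
  by rewrite mule_ge0// lee_fin// expR_ge0.
rewrite indicE; case: (boolP (x \in V)) => [/set_mem Vx|_]; last first.
  by rewrite mule0 expeR_ge0.
rewrite mule1 -[leLHS]/(expeR (s / t i)%:E) lee_expeR EFinM.
by rewrite lee_wpmul2r ?sh// lee_fin invr_ge0 ltW.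
Qed.

(** The integrand is at most 1 on [G] and on [W], as [h <= 0], and at most [exp (b / t)] elsewhere;
    the total mass is 1. *)
Lemma exp_functional_le_cover (h : X -> \bar R) (G W : set X) (b : R) i :
  open G -> open W -> (forall x, h x <= 0) ->
  (forall x, ~ G x -> ~ W x -> h x <= b%:E) ->
  exp_functional mu t h i <=
    (mu i G + (expR (b / t i))%:E + mu i W) `^ t i.
Proof.
move=> oG oW h0 hb; have [mG mW] := (open_borel oG, open_borel oW).
have ti0 : 0 <= ((t i)^-1)%:E by rewrite lee_fin invr_ge0 ltW.
apply: le_poweR; [exact: ltW| |].
  by apply: integral_ge0 => x _; exact: expeR_ge0.
have -> : mu i G + (expR (b / t i))%:E + mu i W =
    \int[mu i]_x ((\1_G x)%:E + (expR (b / t i))%:E + (\1_W x)%:E).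
  have mI (A : set (borelType X)) : measurable A ->
      measurable_fun setT (fun x => (\1_A x)%:E : \bar R).
    by move=> mA; exact/measurable_EFinP.
  rewrite ge0_integralD//=; last 3 first.
  - by move=> x _; rewrite adde_ge0// lee_fin// expR_ge0.
  - by apply: emeasurable_funD; [exact: mI|exact: measurable_cst].
  - exact: mI.
  rewrite ge0_integralD//=; last exact: mI.
  rewrite !integral_indic// !setIT integral_cst//.
  by rewrite [X in _ * X](probability_setT (mu i)) mule1.
apply: ge0_le_integral_setT => x; first exact: expeR_ge0.
have hle1 : expeR (h x * ((t i)^-1)%:E) <= 1.
  by rewrite -expeR0 lee_expeR mule_le0_ge0.
have [Gx|nGx] := pselect (G x).
  rewrite indicE mem_set//= (le_trans hle1)// -addeA leeDl//.
  by rewrite adde_ge0// lee_fin expR_ge0.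
have [Wx|nWx] := pselect (W x).
  rewrite [in \1_W x]indicE (mem_set Wx)/= (le_trans hle1)// leeDr//.
  by rewrite adde_ge0// lee_fin ?expR_ge0// indicE.
rewrite !indicE !memNset// add0e adde0.
rewrite -[leRHS]/(expeR (b / t i)%:E) lee_expeR EFinM.
by rewrite lee_wpmul2r// hb.
Qed.

(** The powered sum is at most [3 ^ t * c'], and [3 ^ t] tends to 1: in the limit a sum counts as
    its largest term. *)
Lemma near_poweR_sum3_le (c' c : R) : (0 < c')%R -> (c' < c)%R ->
  \forall i \near net_filter le, forall x y z : \bar R,
    0 <= x -> 0 <= y -> 0 <= z ->
    x `^ t i <= c'%:E -> y `^ t i <= c'%:E -> z `^ t i <= c'%:E ->
    (x + y + z) `^ t i <= c%:E.
Proof.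
move=> c'0 c'c; have c0 := lt_trans c'0 c'c.
have ln3 : (0 < ln 3 :> R)%R by rewrite ln_gt0// ltr1n.
(* For [t i] below this threshold, [3 ^ t i < c / c']. *)
have e0 : (0 < ln (c / c') / ln 3)%R.
  by rewrite divr_gt0// ln_gt0// ltr_pdivlMr// mul1r.
move/cvgrPdist_lt : t_cvg0 => /(_ _ e0); apply: filterS => i.
rewrite sub0r normrN gtr0_norm// ltr_pdivlMr// => tc x y z x0 y0 z0.
move=> /(poweR_le_root (t_gt0 i) x0) xc /(poweR_le_root (t_gt0 i) y0) yc.
move=> /(poweR_le_root (t_gt0 i) z0) zc.
apply: (@le_trans _ _ ((3 * c' `^ (t i)^-1)%:E `^ t i)).
  apply: le_poweR; [exact: ltW|by rewrite !adde_ge0|].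
  set d := (c' `^ (t i)^-1)%R.
  have -> : (3 * d = d + d + d)%R by ring.
  by rewrite !EFinD !leeD.
rewrite poweR_EFin lee_fin powRM ?powR_ge0// -powRrM mulVf ?gt_eqF//.
rewrite powRr1 ?(ltW c'0)// -ler_pdivlMr//.
rewrite /powR gt_eqF// -[leRHS]lnK ?posrE ?divr_gt0//.
by rewrite ler_expR ltW.
Qed.

(** With [c < c' < d] and [d] arbitrary, the gap from [c'] to [d] absorbs the factor of the sum
    estimate, so the union keeps the constant [c]. *)
Lemma limsup_mu_pow_setU (A B : set X) (c : R) :
  (0 < c)%R -> open A -> open B ->
  net_limsup le (mu_pow mu t A) <= c%:E ->
  net_limsup le (mu_pow mu t B) <= c%:E ->
  net_limsup le (mu_pow mu t (A `|` B)) <= c%:E.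
Proof.
move=> c0 oA oB Ac Bc; apply: le_from_real => d; rewrite lte_fin => cd.
have [c' /andP[]] : exists r : R, c%:E < r%:E < d%:E.
  by apply: ereal_dense; rewrite lte_fin.
rewrite !lte_fin => cc' c'd; have c'0 := lt_trans c0 cc'.
have cc'E : c%:E < c'%:E by rewrite lte_fin.
have nA := near_net_limsup_lt (le_lt_trans Ac cc'E).
have nB := near_net_limsup_lt (le_lt_trans Bc cc'E).
apply: net_limsup_near_le.
apply: filterS3 nA nB (near_poweR_sum3_le c'0 c'd) => i Ai Bi.
move=> /(_ (mu i A) (mu i B) 0); rewrite adde0 poweR0r ?gt_eqF// => /(_ _ _ _ (ltW Ai) (ltW Bi)) sumAB.
apply: (le_trans _ (sumAB _ _ _ _)) => //; last by rewrite lee_fin ltW.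
apply: le_poweR => //; first exact: ltW.
by apply: measureU2; exact: open_borel.
Qed.

Lemma upper_bound (J : X -> \bar R) :
  hausdorff_space X -> exponentially_tight le mu t ->
  (forall x (r : R), r%:E < J x -> exists2 h : X -> R, continuous (h : X -> R^o) &
     r%:E < (h x)%:E - Lambda_sup le mu t (EFin \o h)) ->
  forall F : set X, closed F ->
    net_limsup le (mu_pow mu t F) <= sup_exp_opp J F.
Proof.
move=> hX tight HJ F cF; apply: le_from_real => c Sc.
have c0 : (0 < c)%R.
  by rewrite -lte_fin; apply: le_lt_trans Sc; apply: ereal_sup_ubound; left.
have [K cK Kc] := tight _ c0.
have oKC : open (~` K) by rewrite openC; exact: compact_closed.
(* This family is stable under unions; it remains to find a neighbourhood in it for each point of
   [K] and [F]. *)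
pose P V := open V /\ net_limsup le (mu_pow mu t V) <= c%:E.
have [||x KFx|A [oA Ac] KFA] :=
    @compact_ideal _ (K `&` F) P (compact_closedI cK cF).
- split; first exact: open0.
  apply: net_limsup_near_le; apply: nearW => i.
  by rewrite /mu_pow measure0 poweR0r ?gt_eqF// lee_fin ltW.
- move=> A B [oA Ac] [oB Bc]; split; first exact: openU.
  exact: limsup_mu_pow_setU.
- have [/HJ[h ch hJ]] : (- ln c)%:E < J x.
    rewrite EFinN lteNl -lte_expeR/= lnK ?posrE//.
    apply: le_lt_trans Sc; apply: ereal_sup_ubound; right.
    by exists x => //; case: KFx.
  (* On the set [h > r - ln c], Markov and [Lambda_sup h < r] give eventually
     [exp (r - ln c) * mu^t <= exp r], that is [mu^t <= c]; the bound [r < h x + ln c] puts [x] in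
     this set. *)
  have [r /andP[Lr]] : exists r : R,
      Lambda_sup le mu t (EFin \o h) < r%:E < (h x + ln c)%:E.
    apply: ereal_dense; move: hJ; case: (Lambda_sup _ _ _ _) => //= [l|].
      by rewrite -EFinB !lte_fin; lra.
    by rewrite ltNyr.
  rewrite lte_fin => rh.
  exists (h @^-1` [set y : R^o | (r - ln c < y)%R]).
    by apply: ch; apply: lt_nbhsr => /=; rewrite ltrBlDr.
  have oV : open (h @^-1` [set y : R^o | (r - ln c < y)%R]).
    by apply: open_comp; [move=> y _; exact: ch|exact: open_gt].
  split=> //.
  have {}Lr : net_limsup le (exp_functional mu t (EFin \o h)) < (expR r)%:E.
    rewrite -[X in X < _]expeR_lne; last first.
      by apply: net_limsup_ge0 => i; exact: exp_functional_ge0.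
    by rewrite -[(expR r)%:E]/(expeR r%:E) lte_expeR.
  apply: net_limsup_near_le; apply: filterS (near_net_limsup_lt Lr) => i hr.
  have sh y : (h @^-1` [set y : R^o | (r - ln c < y)%R]) y ->
      (r - ln c)%:E <= (EFin \o h) y.
    by move=> /= /ltW; rewrite lee_fin.
  have := le_lt_trans (markov_exp_functional i oV sh) hr.
  have -> : expR r = (expR (r - ln c) * c)%R.
    by rewrite -[in RHS](@lnK _ c) ?posrE// -expRD lnK ?posrE// subrK.
  by rewrite EFinM lte_pmul2l// ?lte_fin ?expR_gt0// => /ltW.
(* [F] is covered by [A] and the complement of [K]. *)
- have := limsup_mu_pow_setU c0 oA oKC Ac (ltW Kc).
  apply: le_trans; apply: le_net_limsup => // i.
  apply: le_poweR => //; first exact: ltW.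
  apply: le_measure; rewrite ?inE.
  + rewrite -[F]setCK; apply: measurableC; apply: open_borel.
    exact: closed_openC.
  + by apply: open_borel; exact: openU.
  + by move=> x Fx; have [Kx|] := pselect (K x); [left; exact: KFA|right].
Qed.

(* A compact [K] carrying the mass up to [c'] and a suitable [h] with [h x = 0]
   give [exp (h / t) <= 1_G + c' ^ (1 / t) + 1_(~` K)]. *)
Lemma lower_bound (J : X -> \bar R) :
  hausdorff_space X -> exponentially_tight le mu t ->
  (forall x (h : X -> R), neg_finite_min_affine h ->
     (h x)%:E - Lambda_inf le mu t (EFin \o h) <= J x) ->
  forall (G : set X) x, open G -> G x ->
    expeR (- J x) <= net_liminf le (mu_pow mu t G).
Proof.
move=> hX tight HJ G x oG Gx; apply: le_from_real => c Gc.
have [c' /andP[Gc']] := ereal_dense Gc; rewrite lte_fin => c'c.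
have c'0 : (0 < c')%R.
  rewrite -lte_fin; apply: le_lt_trans Gc'; apply: net_liminf_ge0 => i.
  exact: mu_pow_ge0.
have [K cK Kc] := tight _ c'0.
have oKC : open (~` K) by rewrite openC; exact: compact_closed.
(* Taking minima of the functions [h] makes this family stable under unions. *)
pose P V := exists h : X -> R, [/\ neg_finite_min_affine h, h x = 0%R &
  forall z, V z -> (h z <= ln c')%R].
have [||y [Ky nGy]|A [h [hA hx hle]] KGA] :=
    @compact_ideal _ (K `&` ~` G) P (compact_closedI cK (open_closedC oG)).
- exists (fun=> 0%R); split => //; split => //.
  exact/continuous_affine_finite_min/cst_affine.
- move=> A B [h1 [[h1A h1_le0] h1x h1A_le]] [h2 [[h2A h2_le0] h2x h2B_le]].
  exists (fun z => Num.min (h1 z) (h2 z)); split.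
  + split; first exact: finite_min_affine_min.
    by move=> z; rewrite ge_min h1_le0.
  + by rewrite h1x h2x minxx.
  + by move=> z [/h1A_le|/h2B_le] zle; rewrite ge_min zle ?orbT.
- have yx : (y - x != 0)%R.
    by rewrite subr_eq0; apply/eqP => yx; apply: nGy; rewrite yx.
  have [u cu uyx] := continuous_linear_separation hX yx.
  (* The slope makes the affine [f], which vanishes at [x], equal to [ln c' - 1] at [y]; its minimum
     with 0 is then the required [h] near [y]. *)
  pose k := ((1 - ln c') / u (y - x))%R.
  pose v : {linear X -> R^o} := ((- k) \*: u)%R.
  pose f z : R := (v z + k * u x)%R.
  have cf : continuous_affine f.
    exists v, (k * u x)%R; split => // z.
    by apply: cvgZr; exact: cu.
  have fx : f x = 0%R by rewrite /f /v /= scaleNr addNr.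
  have fy : (f y < ln c')%R.
    have -> : f y = (- (k * u (y - x)))%R.
      by rewrite /f /v /= scaleNr linearB /= mulrBr opprB addrC.
    by rewrite /k divfK ?gt_eqF//; lra.
  exists (f @^-1` [set z : R^o | (z < ln c')%R]).
    have := finite_min_affine_continuous (continuous_affine_finite_min cf).
    by move=> /(_ y); apply; exact: lt_nbhsl.
  exists (fun z => Num.min (f z) 0%R); split.
  + split; last by move=> z; rewrite ge_min lexx orbT.
    apply: finite_min_affine_min; apply: continuous_affine_finite_min => //.
    exact: cst_affine.
  + by rewrite fx minxx.
  + by move=> z /ltW zle; rewrite ge_min zle.
- have hc : net_liminf le (exp_functional mu t (EFin \o h)) <= c%:E.
    rewrite leNgt; apply/negP => /near_net_liminf_gt ch.
    have Kn := near_net_limsup_lt Kc.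
    (* At a single index all three terms of the cover have power at most [c'], while the exponential
       functional exceeds [c]. *)
    have [i [chi [Ki sum3]] Gi] := net_liminf_lt_frequently Gc'
      (filterI ch (filterI Kn (near_poweR_sum3_le c'0 c'c))).
    move: chi; rewrite ltNge => /negP; apply.
    apply: (le_trans (exp_functional_le_cover (b := ln c') i oG oKC _ _)).
    + by move=> z; rewrite lee_fin; exact: hA.2.
    + move=> z nGz nKz; rewrite lee_fin; apply/hle/KGA; split => //.
      by apply: contrapT.
    + apply: sum3; rewrite ?measure_ge0 ?lee_fin ?expR_ge0 ?(ltW Gi) ?(ltW Ki)//.
      by rewrite powR_expR_div// lnK ?posrE.
  have := HJ x h hA; rewrite hx sub0e leeNl => Jh.
  apply: le_trans hc.
  rewrite -[leRHS]expeR_lne ?lee_expeR//.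
  by apply: net_liminf_ge0 => i; exact: exp_functional_ge0.
Qed.

(** Markov's inequality passed to the lower limit; real thresholds move the factor [exp s] through
    it. *)
Lemma Lambda_inf_ge (g : X -> \bar R) (s : R) (a : \bar R) (G : set X) :
  open G -> (forall x, G x -> s%:E <= g x) ->
  expeR a <= net_liminf le (mu_pow mu t G) ->
  s%:E + a <= Lambda_inf le mu t g.
Proof.
move=> oG sg aG; rewrite -lee_expeR expeR_lne; last first.
  by apply: net_liminf_ge0 => i; exact: exp_functional_ge0.
rewrite expeRD/= -lee_pdivlMl ?expR_gt0//; apply: (le_trans aG).
rewrite leNgt; apply/negP => /ereal_dense[r /andP[]].
rewrite lte_pdivrMl ?expR_gt0// ltNge => /negP + rG; apply.
apply: net_liminf_near_ge; apply: filterS (near_net_liminf_gt rG) => i /ltW ri.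
apply: le_trans (markov_exp_functional i oG sg).
by rewrite lee_pmul2l// lte_fin expR_gt0.
Qed.

Lemma Lambda_inf_cut_ge (h : X -> R) (M : R) (x : X) (J : \bar R) :
  continuous (h : X -> R^o) -> (h x < M)%R ->
  (forall G : set X, open G -> G x ->
     expeR (- J) <= net_liminf le (mu_pow mu t G)) ->
  (h x)%:E - J <= Lambda_inf le mu t (cut_below h M).
Proof.
move=> ch hxM HJ; apply/lee_addgt0Pr => e e0.
rewrite -leeBlDr// addeAC -EFinN -EFinD.
(* On this open set containing [x] the cut function still equals [h]. *)
pose G := h @^-1` ([set y : R^o | (h x - e < y)%R] `&` [set y | (y < M)%R]).
have oG : open G.
  apply: open_comp; first by move=> y _; exact: ch.
  by apply: openI; [exact: open_gt|exact: open_lt].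
apply: (Lambda_inf_ge oG); last by apply: HJ => //; split => //=; lra.
by move=> y [/= /ltW hy yM]; rewrite /cut_below yM lee_fin.
Qed.

Lemma Lambda_inf_le (g h : X -> \bar R) : (forall x, g x <= h x) ->
  Lambda_inf le mu t g <= Lambda_inf le mu t h.
Proof.
move=> gh; apply: le_lne.
  by apply: net_liminf_ge0 => i; exact: exp_functional_ge0.
by apply: le_net_liminf => i; exact: exp_functional_le.
Qed.

Lemma Lambda_inf_le_sup (h : X -> \bar R) :
  Lambda_inf le mu t h <= Lambda_sup le mu t h.
Proof.
apply: le_lne; last exact: net_liminf_le_limsup.
by apply: net_liminf_ge0 => i; exact: exp_functional_ge0.
Qed.

(** The cuts increase with [M], so the limit can be compared with each single cut. *)
Lemma lim_Lambda_inf_cut (h : X -> R) :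
  lim (Lambda_inf le mu t (cut_below h M) @[M --> +oo%R]) =
  ereal_sup (range (fun M => Lambda_inf le mu t (cut_below h M))).
Proof.
apply: cvg_lim; first exact: ereal_hausdorff.
apply: nondecreasing_cvge => M N MN; apply: Lambda_inf_le => x.
rewrite /cut_below; case: ifPn => [hM|_]; last exact: leNye.
by rewrite (lt_le_trans hM MN).
Qed.

Lemma Lambda_inf0 : Lambda_inf le mu t (fun=> 0) = 0.
Proof.
have e1 : exp_functional mu t (fun=> 0) = fun=> 1.
  apply/funext => i; rewrite /exp_functional.
  rewrite -[X in X `^ _](_ : \int[mu i]_x cst 1 x = _).
    rewrite integral_cst// mul1e.
    by rewrite [X in X `^ _](probability_setT (mu i)) poweR1r.
  by apply: eq_integral => x _; rewrite mul0e expeR0.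
rewrite /Lambda_inf e1 -[RHS]lne1; congr lne; apply/le_anti/andP; split.
  rewrite (le_trans (net_liminf_le_limsup le_directed _))//.
  by apply: net_limsup_near_le; exact: nearW.
by apply: net_liminf_near_ge; exact: nearW.
Qed.

Lemma Lambda_exists_eq (h : X -> \bar R) : Lambda_exists le mu t h ->
  Lambda_sup le mu t h = Lambda le mu t h /\
  Lambda_inf le mu t h = Lambda le mu t h.
Proof.
move=> /(net_cvg_limits le_directed)[hs hi].
by rewrite /Lambda_sup hs /Lambda_inf hi.
Qed.

End LargeDeviationBounds.

(** * The principle and the four formulas for the rate function *)

Theorem corollary3 (R : realType) (X : tvsType R)
    (X_hausdorff : hausdorff_space X)
    (X_nontrivial : exists x y : X, x <> y)
    (I : Type) (le : I -> I -> Prop) (le_directed : directed_preorder le)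
    (mu : I -> probability (borelType X) R)
    (t : I -> R) (t_gt0 : forall i, 0 < t i)
    (t_cvg0 : t @ net_filter le --> (0 : R))
    (mu_tight : exponentially_tight le mu t)
    (Lambda_ex : forall h : X -> R, neg_finite_min_affine h ->
       Lambda_exists le mu t (EFin \o h)) :
  exists J : X -> \bar R,
    ldp_with_rate_function le mu t J /\
    forall x : X,
      [/\ J x = ereal_sup [set ((h x)%:E - Lambda le mu t (EFin \o h))%E
                          | h in @neg_finite_min_affine R X],
          J x = ereal_sup [set ((h x)%:E - Lambda_sup le mu t (EFin \o h))%E
                          | h in @finite_min_affine R X],
          J x = ereal_sup [set ((h x)%:E - Lambda_inf le mu t (EFin \o h))%E
                          | h in @finite_min_affine R X]
        & J x = ereal_sup
                  [set ((h x)%:E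
                        - lim (Lambda_inf le mu t (cut_below h M)
                               @[M --> +oo%R]))%E
                  | h in @finite_min_affine R X]].
Proof.
(* [Lambda_inf] is the form that [lower_bound] takes; [negE] converts it to [Lambda_sup] for the
   upper bound and to [Lambda] for the first formula. *)
pose J x := ereal_sup [set ((h x)%:E - Lambda_inf le mu t (EFin \o h))%E
                      | h in @neg_finite_min_affine R X].
have negE h : neg_finite_min_affine h ->
    Lambda_sup le mu t (EFin \o h) = Lambda le mu t (EFin \o h) /\
    Lambda_inf le mu t (EFin \o h) = Lambda le mu t (EFin \o h).
  by move=> /Lambda_ex; exact: Lambda_exists_eq.
have lower : forall (G : set X) x, open G -> G x ->
    (expeR (- J x) <= net_liminf le (mu_pow mu t G))%E.
  apply: lower_bound => // x h hA.
  by apply: ereal_sup_ubound; exists h.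
have neg_sup x (r : R) : (r%:E < J x)%E -> exists2 h, neg_finite_min_affine h &
    (r%:E < (h x)%:E - Lambda_inf le mu t (EFin \o h))%E.
  by move=> /ereal_sup_gt[_ [h hA <-] rh]; exists h.
have neg_continuous h : neg_finite_min_affine h -> continuous (h : X -> R^o).
  by move=> [hA _]; exact: finite_min_affine_continuous.
have upper : forall F : set X, closed F ->
    (net_limsup le (mu_pow mu t F) <= sup_exp_opp J F)%E.
  apply: upper_bound => // x r /neg_sup[h hA rh].
  exists h; first exact: neg_continuous.
  by rewrite (negE h hA).1 -(negE h hA).2.
have J_lsc : lower_semicontinuous J.
  move=> x a /neg_sup[h hA].
  have Jh y : ((h y)%:E - Lambda_inf le mu t (EFin \o h) <= J y)%E.
    by apply: ereal_sup_ubound; exists h.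
  move: Jh; case: (Lambda_inf _ _ _ _) => [l| |] Jh ah //.
    exists (h @^-1` [set y : R^o | a + l < y]).
      apply: (neg_continuous h hA); apply: lt_nbhsr.
      by move: ah; rewrite -EFinB lte_fin ltrBrDr.
    move=> y /= ahy; apply: lt_le_trans (Jh y).
    by rewrite -EFinB lte_fin ltrBrDr.
  (* Here [Lambda_inf h] is [-oo], so [J] is [+oo] everywhere. *)
  exists setT; first exact: filterT.
  by move=> y _; apply: lt_le_trans (Jh y); rewrite ltry.
have J_ge0 x : (0 <= J x)%E.
  apply: ereal_sup_ubound; exists (fun=> 0).
    split=> //; exact/continuous_affine_finite_min/cst_affine.
  by rewrite [Lambda_inf _ _ _ _]Lambda_inf0// sube0.
(* The last three formulas follow from two comparisons, with [F] being [Lambda_sup], [Lambda_inf] or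
   the limit of cuts: [F] is at most [Lambda_inf] on negative minima, and on all minima it dominates
   a cut at some [M > h x]. *)
have sup_ge (F : (X -> R) -> \bar R) x :
    (forall h, neg_finite_min_affine h ->
      F h <= Lambda_inf le mu t (EFin \o h))%E ->
    (J x <= ereal_sup [set (h x)%:E - F h | h in @finite_min_affine R X])%E.
  move=> FL; apply: ge_ereal_sup => _ [h hA <-]; apply: le_ereal_sup_tmp.
  exists ((h x)%:E - F h)%E; first by exists h => //; case: hA.
  by rewrite leeB// FL.
have sup_le (F : (X -> R) -> \bar R) x :
    (forall h, finite_min_affine h -> exists2 M, h x < M &
      (Lambda_inf le mu t (cut_below h M) <= F h)%E) ->
    (ereal_sup [set (h x)%:E - F h | h in @finite_min_affine R X] <= J x)%E.
  move=> LF; apply: ge_ereal_sup => _ [h hA <-]; have [M hM] := LF h hA.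
  move=> /(le_trans _) LFh; apply/leeB_swap/LFh.
  apply: Lambda_inf_cut_ge => //; first exact: finite_min_affine_continuous.
  by move=> G oG Gx; exact: lower.
have cut_le h M : (Lambda_inf le mu t (cut_below h M) <=
    Lambda_inf le mu t (EFin \o h))%E.
  by apply: Lambda_inf_le => // x; rewrite /cut_below; case: ifP; rewrite ?leNye.
exists J; split.
  (* Being lower semicontinuous, [J] is its own lower regularization. *)
  exists J; split=> //; split=> //.
  move=> G oG; apply: ge_ereal_sup => _ [->|[x Gx <-]]; last exact: lower.
  by apply: net_liminf_ge0 => // i; exact: mu_pow_ge0.
move=> x; split.
- by congr ereal_sup; apply: eq_imagel => h /negE[_ ->].
- apply/le_anti/andP; split.
    by apply: sup_ge => h /negE[-> ->].
  apply: sup_le => h hA; exists (h x + 1); first by rewrite ltrDl.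
  by rewrite (le_trans (cut_le _ _))// Lambda_inf_le_sup.
- apply/le_anti/andP; split; first exact: sup_ge.
  by apply: sup_le => h hA; exists (h x + 1); rewrite ?ltrDl.
- apply/le_anti/andP; split.
    apply: sup_ge => h hA; rewrite lim_Lambda_inf_cut//.
    by apply: ge_ereal_sup => _ [M _ <-].
  apply: sup_le => h hA; exists (h x + 1); first by rewrite ltrDl.
  by rewrite lim_Lambda_inf_cut//; apply: ereal_sup_ubound; exists (h x + 1).
Qed.
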